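(* For any two states $s,s'\in S$ of the BDM, $$\mu_\infty(s)=\mu_\infty(s')\cdot q^{K(s')-K(s)},$$ i.e. $\mu_\infty(s)/\mu_\infty(s')=q^{K(s')-K(s)}$; in particular $\mu_\infty(s)=\mu_\infty(s_0)\,q^{-K(s)}$ for all $s\in S$.
   Context: Fix integers $M\ge 1$ and $q\ge 2$. The augmented state set is $\overline S=\{(b_1,\dots,b_M,d;T,t): b_m,d,T\in\mathbb Z,\ 1\le t\le M+1,\ d+T+\sum_{m=1}^M b_m=0\}$, the BDM state set is $S=\{s\in\overline S: 0\le T\le M\}$, initial state $s_0=(0,\dots,0,0;0,M+1)$. The BDM is the Markov chain on $S$ with transitions from $s=(b_1,\dots,b_M,d;T,t)$: (a) if $t\le M$ and $b_t>d$: with probability $(q-1)/q$ (action $D$) to $(b_1,\dots,b_{t-1},d,b_{t+1},\dots,b_M,b_t;T,t+1)$, and with probability $1/q$ (action $I$) to $(b_1,\dots,b_M,d;T,t+1)$; (b) if $t\le M$ and $b_t\le d$: with probability $1$ to $(b_1,\dots,b_M,d;T,t+1)$ (action $N_=$ if $b_t=d$, $N_<$ if $b_t<d$); (c) if $t=M+1$, $T<M$: with probability 1 to $(b_1,\dots,b_M,d-1;T+1,1)$; (d) if $t=M+1$, $T=M$: with probability 1 to $(b_1+1,\dots,b_M+1,d;0,1)$. With transition probabilities $p(s,s')$, let $\mu_0$ be the point mass at $s_0$ and $\mu_{\tau+1}(s')=\sum_{s}\mu_\tau(s)p(s,s')$. The asymptotic measure is $\mu_\infty(s)=\limsup_{\tau\to\infty}\mu_\tau(s)$.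 For $s\in\overline S$ let $x=(b_1,\dots,b_{t-1},d,b_t,\dots,b_M)$ ($d$ in position $t$), $\tilde b_1\ge\dots\ge\tilde b_{M+1}$ its entries sorted nonincreasingly, $\pi_s$ the minimum number of neighbouring transpositions needed to sort $x$ nonincreasingly, and $K(s)=-\pi_s+MT+2\sum_{m=1}^{M+1}\tilde b_m(M+1-m)$ the class of $s$. *)

(* Defs.v *)
From HB Require Import structures.
From mathcomp Require Import all_boot all_order all_algebra.
From mathcomp Require Import all_classical all_reals all_analysis.
Set Implicit Arguments. Unset Strict Implicit. Unset Printing Implicit Defensive.
Import Order.TTheory GRing.Theory Num.Theory.
Local Open Scope ring_scope.

(* An augmented state (b_1..b_M, d; T, t) is encoded as ((b, d), T, t)
   with b : seq int (b_m = nth 0 b (m-1)). *)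
Definition state := ((seq int * int) * int * nat)%type.
Definition st_b (s : state) : seq int := s.1.1.1.
Definition st_d (s : state) : int := s.1.1.2.
Definition st_T (s : state) : int := s.1.2.
Definition st_t (s : state) : nat := s.2.

Definition in_Sbar (M : nat) (s : state) : bool :=
  [&& size (st_b s) == M,
      st_d s + st_T s + \sum_(x <- st_b s) x == 0,
      (1 <= st_t s)%N & (st_t s <= M.+1)%N].

Definition in_S (M : nat) (s : state) : bool :=
  [&& in_Sbar M s, 0 <= st_T s & st_T s <= M%:Z].

Definition s0 (M : nat) : state := ((nseq M 0, 0), 0, M.+1).

Definition step (R : realType) (M q : nat) (s : state) : seq (R * state) :=
  let b := st_b s in let d := st_d s in let T := st_T s in let t := st_t s in
  if (t <= M)%N then
    let bt := nth 0 b t.-1 in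
    if d < bt then
      [:: ((q%:R - 1) / q%:R, ((set_nth 0 b t.-1 d, bt), T, t.+1));
          (1 / q%:R, ((b, d), T, t.+1))]
    else [:: (1, ((b, d), T, t.+1))]
  else if T < M%:Z then [:: (1, ((b, d - 1), T + 1, 1%N))]
  else [:: (1, ((map (fun x => x + 1) b, d), 0, 1%N))].

Fixpoint dist (R : realType) (M q : nat) (tau : nat) : seq (R * state) :=
  match tau with
  | 0%N => [:: (1, s0 M)]
  | n.+1 => flatten [seq [seq (x.1 * y.1, y.2) | y <- step R M q x.2]
                    | x <- dist R M q n]
  end.

(* mu_tau(s) = sum_{s'} mu_{tau-1}(s') p(s', s) *)
Definition mu (R : realType) (M q : nat) (tau : nat) (s : state) : R :=
  \sum_(x <- dist R M q tau | x.2 == s) x.1.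

Definition mu_inf (R : realType) (M q : nat) (s : state) : R :=
  limn_sup (fun tau => mu R M q tau s).

Definition xseq (s : state) : seq int :=
  take (st_t s).-1 (st_b s) ++ st_d s :: drop (st_t s).-1 (st_b s).

Definition noninc (x : seq int) : bool := sorted (fun a b => b <= a) x.

Definition adjswap (x : seq int) (i : nat) : seq int :=
  if (i.+1 < size x)%N then set_nth 0 (set_nth 0 x i (nth 0 x i.+1)) i.+1 (nth 0 x i)
  else x.

(* x can be sorted nonincreasingly with (at most) n neighbouring transpositions *)
Definition sortable_in (x : seq int) (n : nat) : bool :=
  [exists f : n.-tuple 'I_(size x), noninc (foldl adjswap x (map val f))].

(* pi: minimum number of neighbouring transpositions sorting x nonincreasingly;
   the search range 0..(size x)^2 always contains the minimum. *)
Definition pi_min (x : seq int) : nat :=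
  find (sortable_in x) (iota 0 ((size x) ^ 2).+1).

Definition K (M : nat) (s : state) : int :=
  let x := xseq s in
  let tb := sort (fun a b => b <= a) x in
  - (pi_min x)%:Z + M%:Z * st_T s
  + 2 * \sum_(i < M.+1) tb`_i * (M - i)%:Z.

(* Main.v *)
(** Let [x = xseq s], so that [T] is minus the sum of [x]. Both the sorting distance
    and the weighted sum of sorted entries are sums over pairs of positions, and
    [K s] is the sum over [i < j] of [phi (x_i - x_j)], where [phi u = u] for [u >= 0]
    and [phi u = - u - 1] for [u < 0]. On [x], actions (a) and (b) keep or swap two
    neighbouring entries and actions (c) and (d) move the last entry to the front
    without changing [K], so one checks that [q ^ (- K)] is a stationary measure.
    It is summable, because [K] dominates the l1-norm up to a constant.

    Let [L] be the limsup of [mu tau / q ^ (- K)]. It is bounded and subharmonic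
    for the time-reversed chain, hence so is [L ^ 2]; the sum of [q ^ (- K) * L ^ 2]
    is finite and invariant under a time step, which forces equality in Jensen's
    inequality: [L] takes equal values at the two ends of every transition. So [L]
    does not depend on [t], is symmetric in the entries of [x], and is invariant under
    raising an entry when [T > 0]; hence it is constant. The limsup makes any
    discussion of convergence or periodicity unnecessary. *)
Require Import Defs.
From HB Require Import structures.
From mathcomp Require Import all_boot all_order all_algebra.
From mathcomp Require Import all_classical all_reals all_analysis.
From mathcomp Require Import zify ring lra.
Import Order.TTheory GRing.Theory Num.Theory.
Set Implicit Arguments. Unset Strict Implicit. Unset Printing Implicit Defensive.
Local Open Scope classical_set_scope.
Local Open Scope ring_scope.

(** * The class as a pair energy *)

Lemma sum_const_seq (T : Type) (x : seq T) (c : int) : \sum_(a <- x) c = (size x)%:Z * c.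
Proof.
by elim: x => [|a s IH]; rewrite ?big_nil ?mul0r // big_cons IH /= intS mulrDl mul1r.
Qed.

Fixpoint pairsum {T : Type} (f : T -> T -> int) (x : seq T) : int :=
  if x is a :: s then \sum_(b <- s) f a b + pairsum f s else 0.

Lemma pairsum_cat (T : Type) (f : T -> T -> int) (s1 s2 : seq T) :
  pairsum f (s1 ++ s2) =
  pairsum f s1 + pairsum f s2 + \sum_(a <- s1) \sum_(b <- s2) f a b.
Proof.
elim: s1 => [|a s IH] /=; first by rewrite big_nil addr0 add0r.
by rewrite IH big_cat big_cons /=; ring.
Qed.

(** An exchange of neighbours keeps the relative order of every other pair, so a single term of the
    sum changes. *)
Lemma pairsum_swap (T : Type) (f : T -> T -> int) (s1 s2 : seq T) (a b : T) :
  pairsum f (s1 ++ b :: a :: s2) = pairsum f (s1 ++ a :: b :: s2) + (f b a - f a b).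
Proof.
rewrite !pairsum_cat /= !big_cons.
have -> : \sum_(c <- s1) \sum_(d <- b :: a :: s2) f c d =
          \sum_(c <- s1) \sum_(d <- a :: b :: s2) f c d.
  by apply: eq_bigr => c _; rewrite !big_cons addrCA.
ring.
Qed.

Lemma pairsum_double (T : Type) (f : T -> T -> int) (x : seq T) :
  (forall a b, f a b = f b a) -> (forall a, f a a = 0) ->
  \sum_(a <- x) \sum_(b <- x) f a b = 2 * pairsum f x.
Proof.
move=> fC f0; elim: x => [|a s IH] /=; first by rewrite big_nil.
rewrite big_cons big_cons f0.
under [X in _ + X = _]eq_bigr do rewrite big_cons.
rewrite big_split /= IH [X in _ + (X + _)](eq_bigr (f a)) => [|b _]; last exact: fC.
ring.
Qed.

Lemma perm_pairsum (T : eqType) (f : T -> T -> int) (x y : seq T) :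
  (forall a b, f a b = f b a) -> (forall a, f a a = 0) -> perm_eq x y ->
  pairsum f x = pairsum f y.
Proof.
move=> fC f0 xy; suff : 2 * pairsum f x = 2 * pairsum f y by lia.
rewrite -!pairsum_double // (perm_big _ xy) /=.
by apply: eq_bigr => a _; rewrite (perm_big _ xy).
Qed.

(** * Neighbouring transpositions and inversions *)

Lemma adjswapP (x : seq int) (i : nat) : (i.+1 < size x)%N ->
  exists s1 s2, [/\ size s1 = i, x = s1 ++ x`_i :: x`_i.+1 :: s2 &
    adjswap x i = s1 ++ x`_i.+1 :: x`_i :: s2].
Proof.
move=> hi; exists (take i x), (drop i.+2 x).
have e : x = take i x ++ x`_i :: x`_i.+1 :: drop i.+2 x.
  by rewrite -drop_nth // -drop_nth ?cat_take_drop // ltnW.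
have st : size (take i x) = i by rewrite size_takel // ltnW // ltnW.
split => //; rewrite /adjswap hi.
have swap_at (s y : seq int) (a b : int) :
    set_nth 0 (set_nth 0 (s ++ a :: b :: y) (size s) b) (size s).+1 a = s ++ b :: a :: y.
  by elim: s => //= c s IH; congr (_ :: _).
by have := swap_at (take i x) (drop i.+2 x) x`_i x`_i.+1; rewrite -e st.
Qed.

Lemma size_adjswap (x : seq int) (i : nat) : size (adjswap x i) = size x.
Proof.
rewrite /adjswap; case: ifP => // h; rewrite !size_set_nth; lia.
Qed.

Lemma adjswap_nth (x : seq int) (i : nat) : (i.+1 < size x)%N ->
  (adjswap x i)`_i = x`_i.+1 /\ (adjswap x i)`_i.+1 = x`_i.
Proof.
move=> h; rewrite /adjswap h; split; rewrite nth_set_nth /=; last by rewrite eqxx.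
by rewrite (ltn_eqF (ltnSn i)) nth_set_nth /= eqxx.
Qed.

Lemma adjswapK (x : seq int) (i : nat) : adjswap (adjswap x i) i = x.
Proof.
have [h|h] := boolP (i.+1 < size x)%N; last by rewrite /adjswap !(negbTE h).
have h' : (i.+1 < size (adjswap x i))%N by rewrite size_adjswap.
apply: (@eq_from_nth _ 0) => [|j _]; first by rewrite !size_adjswap.
rewrite {1}/adjswap h' !nth_set_nth /= nth_set_nth /=.
have [e1 e2] := adjswap_nth h.
case: eqP => [->|n1]; first by [].
case: eqP => [->|n2]; first by [].
rewrite /adjswap h !nth_set_nth /= nth_set_nth /=.
by do 2 (case: eqP => //).
Qed.

Lemma perm_adjswap (x : seq int) (i : nat) : perm_eq (adjswap x i) x.
Proof.
have [h|h] := boolP (i.+1 < size x)%N; last by rewrite /adjswap (negbTE h).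
have [s1 [s2 [_ ex ->]]] := adjswapP h.
by rewrite [X in perm_eq _ X]ex perm_cat2l; apply/permP => p /=; rewrite addnCA.
Qed.

Lemma adjswap_id (x : seq int) (i : nat) : x`_i = x`_i.+1 -> adjswap x i = x.
Proof.
move=> e; have [h|h] := boolP (i.+1 < size x)%N; last by rewrite /adjswap (negbTE h).
by have [s1 [s2 [_ ex ->]]] := adjswapP h; rewrite [RHS]ex e.
Qed.

Lemma pairsum_adjswap (f : int -> int -> int) (x : seq int) (i : nat) :
  (i.+1 < size x)%N ->
  pairsum f (adjswap x i) = pairsum f x + (f x`_i.+1 x`_i - f x`_i x`_i.+1).
Proof.
move=> h; have [s1 [s2 [_ ex ->]]] := adjswapP h.
by rewrite pairsum_swap [X in _ = pairsum f X + _]ex.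
Qed.

Definition inversions (x : seq int) : int := pairsum (fun a b => if a < b then 1 else 0) x.

Lemma inversions_ge0 (x : seq int) : 0 <= inversions x.
Proof.
rewrite /inversions; elim: x => [|a s IH] //=.
by rewrite addr_ge0 // sumr_ge0 // => b _; case: ifP.
Qed.

Lemma inversions_le (x : seq int) : inversions x <= (size x ^ 2)%N%:Z.
Proof.
rewrite /inversions; elim: x => [|a s IH] //=.
have : \sum_(b <- s) (if a < b then 1 else 0) <= (size s)%:Z.
  elim: s {IH} => [|b s IH]; rewrite ?big_nil ?big_cons //=.
  by move: (bigop _ _ _) IH => S; case: (a < b); lia.
by move: (bigop _ _ _) (pairsum _ _) IH => S P; nia.
Qed.

Lemma inversions_noninc (x : seq int) : noninc x -> inversions x = 0.
Proof.
have tr : transitive (fun a b : int => b <= a) by move=> b a c ? ?; lia.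
rewrite /noninc /inversions; elim: x => [|a s IH] //= p.
rewrite IH ?addr0; last exact: path_sorted p.
move/(order_path_min tr)/allP: p => p.
by rewrite big_seq big1 // => b /p ab; rewrite ltNge ab.
Qed.

Lemma nonincPn (x : seq int) :
  ~~ noninc x -> exists2 i, (i.+1 < size x)%N & x`_i < x`_i.+1.
Proof.
move=> h; apply: contrapT => ne; move/negP: h; apply.
apply/(sortedP 0) => i hi; rewrite leNgt; apply/negP => lt; apply: ne; by exists i.
Qed.

Lemma inversions_adjswap (x : seq int) (i : nat) :
  inversions x <= inversions (adjswap x i) + 1.
Proof.
have [h|h] := boolP (i.+1 < size x)%N; last by rewrite /adjswap (negbTE h); lia.
rewrite /inversions pairsum_adjswap //.
by move: (pairsum _ _) => S; do 2 (case: (_ < _)); lia.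
Qed.

(** Each swap removes at most one inversion; this is the lower bound on the length of any
    sorting. *)
Lemma inversions_foldl (x : seq int) (f : seq nat) :
  inversions x <= inversions (foldl adjswap x f) + (size f)%:Z.
Proof.
elim: f x => [|i f IH] x /=; first by rewrite addr0.
have := IH (adjswap x i); have := inversions_adjswap x i; lia.
Qed.

(** Bubble sort: a sequence that is not nonincreasing has a neighbouring ascent, and swapping it
    removes exactly one inversion. *)
Lemma sort_by_swaps (n : nat) (x : seq int) : inversions x = n%:Z ->
  exists f : seq nat, [/\ size f = n, all (fun i => (i < size x)%N) f &
    noninc (foldl adjswap x f)].
Proof.
elim: n x => [|n IH] x hx.
  (* An ascent would leave $-1$ inversions after its swap. *)
  exists [::]; split => //=; apply: contrapT => /negP /nonincPn [i hi lt].
  have := inversions_ge0 (adjswap x i).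
  rewrite /inversions pairsum_adjswap // -/(inversions x) hx lt (lt_gtF lt); lia.
have /nonincPn [i hi lt] : ~~ noninc x.
  by apply/negP => /inversions_noninc; rewrite hx.
have [|f [sf af nf]] := IH (adjswap x i).
  rewrite /inversions pairsum_adjswap // -/(inversions x) hx lt (lt_gtF lt); lia.
exists (i :: f); rewrite /= sf; split => //.
by rewrite ltnW //=; move: af; rewrite size_adjswap.
Qed.

Lemma sortable_inP (x : seq int) (n : nat) :
  reflect (exists f : seq nat, [/\ size f = n, all (fun i => (i < size x)%N) f &
    noninc (foldl adjswap x f)]) (sortable_in x n).
Proof.
apply: (iffP existsP) => [[f hf]|[f [sf af nf]]].
  exists (map val f); split => //; first by rewrite size_map size_tuple.
  by apply/allP => _ /mapP [i _ ->] /=.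
(* All indices are in range, so [insub] drops none of them. *)
have e : [seq val i | i <- pmap (insub : nat -> option 'I_(size x)) f] = f.
  rewrite pmap_filter; last exact: insubK.
  by apply/all_filterP; apply: sub_all af => i hi /=; rewrite insubT.
have s : size (pmap (insub : nat -> option 'I_(size x)) f) == n.
  by rewrite -sf -{2}e size_map.
by exists (Tuple s); rewrite /= e.
Qed.

(** Bubble sort attains the lower bound, and [inversions_le] places this value inside the search
    range. Since the range starts at [0], the position returned by [find] is the value itself. *)
Lemma pi_minE (x : seq int) : (pi_min x)%:Z = inversions x.
Proof.
have [n hn] : exists n : nat, inversions x = n%:Z.
  by exists `|inversions x|%N; have := inversions_ge0 x; lia.
have yes : sortable_in x n by apply/sortable_inP; exact: sort_by_swaps.
have no k : sortable_in x k -> (n <= k)%N.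
  move=> /sortable_inP [f [sf _ nf]].
  by have := inversions_foldl x f; rewrite (inversions_noninc nf) hn sf; lia.
have bn : (n < (size x ^ 2).+1)%N by have := inversions_le x; rewrite hn; lia.
rewrite hn /pi_min; set m := find _ _.
have hm : has (sortable_in x) (iota 0 (size x ^ 2).+1).
  by apply/hasP; exists n => //; rewrite mem_iota.
have mlt : (m < (size x ^ 2).+1)%N by have := hm; rewrite has_find size_iota.
have := nth_find 0%N hm; rewrite -/m nth_iota // add0n => /no nm.
have [lt|lt|->] //= := ltngtP m n; first by lia.
have := @before_find _ 0%N (sortable_in x) (iota 0 (size x ^ 2).+1) n lt.
by rewrite nth_iota // add0n yes.
Qed.

(** * The energy, its changes under the moves, and its growth *)

Definition phi (u : int) : int := if 0 <= u then u else - u - 1.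

Definition energy (x : seq int) : int := pairsum (fun a b => phi (a - b)) x.

Lemma pairsum_absE (x : seq int) :
  pairsum (fun a b => `|a - b|) x = energy x + inversions x.
Proof.
rewrite /energy /inversions; elim: x => [|a s IH] //=.
rewrite IH addrACA -big_split /=; congr (_ + _).
by apply: eq_bigr => b _; rewrite /phi; case: ifP; case: ifP; lia.
Qed.

(* In a nonincreasing sequence the m-th entry occurs with sign + in the
   differences to the later entries and with sign - in those to the earlier ones. *)
Lemma pairsum_abs_noninc (n : nat) (x : seq int) : noninc x -> size x = n.+1 ->
  pairsum (fun a b => `|a - b|) x =
  2 * \sum_(i < n.+1) x`_i * (n - i)%:Z - n%:Z * \sum_(a <- x) a.
Proof.
have tr : transitive (fun a b : int => b <= a) by move=> b a c ? ?; lia.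
rewrite /noninc; elim: n x => [|n IH] [|a s] //= p.
  case: s p => // p _.
  by rewrite big_nil big_ord1 big_seq1 /= subnn; ring.
move=> [ss]; rewrite IH ?(path_sorted p) // [in RHS]big_ord_recl /= subn0 big_cons.
have -> : \sum_(b <- s) `|a - b| = n.+1%:Z * a - \sum_(b <- s) b.
  move/(order_path_min tr)/allP: p => p.
  rewrite big_seq (eq_bigr (fun b => a - b)) => [|b /p ab]; last by lia.
  by rewrite -big_seq sumrB sum_const_seq ss.
rewrite [X in _ = 2 * (_ + X) - _](eq_bigr (fun i : 'I_n.+1 => s`_i * (n - i)%:Z)) => [|i _]; last first.
  by rewrite /= /bump add1n subSS.
rewrite intS; ring.
Qed.

(** The sum of $|x_i-x_j|$ over pairs is the same for [x] and for its sorted version. On the former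
    it is energy plus inversions, on the latter the weighted sum plus $MT$, because the entries add
    up to $-T$. *)
Lemma KE (M : nat) (s : state) : in_Sbar M s -> K M s = energy (xseq s).
Proof.
case: s => [[[b d] T] t] /and4P[/eqP /= sb /eqP /= sumE t1 tM].
rewrite /K pi_minE /=; set x := xseq _.
have xp : perm_eq x (d :: b).
  by rewrite /x /xseq perm_catC /= perm_cons perm_catC cat_take_drop.
have sx : size x = M.+1 by rewrite (perm_size xp) /= -sb.
have sumx : \sum_(a <- x) a = - T.
  by rewrite (perm_big _ xp) /= big_cons; move: sumE; rewrite /st_b /st_d /st_T /=; lra.
set tb := sort _ x.
have tbp : perm_eq tb x by rewrite perm_sort.
have tbs : noninc tb by apply: sort_sorted => u v; lia.
have := pairsum_abs_noninc tbs (etrans (perm_size tbp) sx).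
rewrite (perm_big _ tbp) /= sumx (perm_pairsum _ _ tbp); first last.
- by move=> a; rewrite subrr normr0.
- by move=> a c; exact: distrC.
rewrite pairsum_absE /st_T /=; lra.
Qed.

Lemma phi_swap (u : int) : 0 < u -> phi u = phi (- u) + 1.
Proof. by rewrite /phi; do 2 case: ifP; lia. Qed.

(** Moving the last entry [d] to the front as [d - 1] turns a difference $u=a-d$ into $d-1-a=-1-u$;
    this symmetry is what keeps the energy fixed. *)
Lemma phi_reflect (u : int) : phi (- 1 - u) = phi u.
Proof. by rewrite /phi; do 2 case: ifP; lia. Qed.

Lemma energy_adjswap (x : seq int) (i : nat) : (i.+1 < size x)%N ->
  x`_i < x`_i.+1 -> energy (adjswap x i) = energy x + 1.
Proof.
move=> hi lt; rewrite /energy pairsum_adjswap //; congr (_ + _).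
by rewrite phi_swap ?subr_gt0 // opprB addrAC subrr add0r.
Qed.

Lemma energy_nseq0 (n : nat) : energy (nseq n 0) = 0.
Proof.
rewrite /energy; elim: n => //= n ->; rewrite addr0 big1_seq // => a.
by rewrite mem_nseq => /andP[_ /andP[_ /eqP ->]].
Qed.

(** Summing $(M+1)|a|\le\sum_b|a-b|+|\sum_b b|$ over the entries bounds the l1-norm by twice the sum
    of $|x_i-x_j|$ over pairs, up to a constant. As $M+1\ge2$, the factor two is absorbed on the
    left; the inversions cost at most $(M+1)^2$. *)
Lemma energy_lower_bound (M : nat) (x : seq int) : size x = M.+1 ->
  0 <= - \sum_(a <- x) a <= M%:Z -> (1 <= M)%N ->
  \sum_(a <- x) `|a| - 2 * (M.+1 ^ 2)%N%:Z <= energy x.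
Proof.
move=> sx sumx M1.
have H : M.+1%:Z * \sum_(a <- x) `|a| <=
    2 * pairsum (fun a b => `|a - b|) x + M.+1%:Z * M%:Z.
  rewrite -pairsum_double; first last.
  - by move=> a; rewrite subrr normr0.
  - by move=> a c; exact: distrC.
  rewrite big_distrr /=.
  have -> : M.+1%:Z * M%:Z = \sum_(a <- x) M%:Z.
    by rewrite sum_const_seq sx.
  rewrite -big_split /=; apply: ler_sum => a _.
  have e : M.+1%:Z * a = \sum_(b <- x) (a - b) + \sum_(b <- x) b.
    rewrite -big_split /= -sx; under eq_bigr do rewrite subrK.
    by rewrite sum_const_seq.
  have -> : M.+1%:Z * `|a| = `|M.+1%:Z * a| by rewrite normrM.
  rewrite e (le_trans (ler_normD _ _)) // lerD ?ler_norm_sum //.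
  by rewrite ler_norml; lia.
have := inversions_le x; rewrite pairsum_absE sx in H *.
have P : 0 <= \sum_(a <- x) `|a| by rewrite sumr_ge0.
by move: (bigop _ _ _) (energy x) (inversions x) P H => S E I; nia.
Qed.

(** * Limits superior and unordered sums *)

Lemma limn_sup_inf (R : realType) (u : nat -> R) (c : R) :
  (forall n, 0 <= u n <= c) ->
  [/\ limn_sup u = inf (range (sups u)), has_lbound (range (sups u)) &
   forall n, has_ubound (sdrop u n)].
Proof.
move=> uc.
have ub : has_ubound (range u) by exists c => _ [n _ <-]; case/andP: (uc n).
have lb : has_lbound (range u) by exists 0 => _ [n _ <-]; case/andP: (uc n).
have ubd n : has_ubound (sdrop u n) by exact: has_ubound_sdrop.
split => //; first by apply/cvg_lim => //; exact: cvg_sups_inf.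
exists 0 => _ [n _ <-]; rewrite (@le_trans _ _ (u n)) //; first by case/andP: (uc n).
by apply: ub_le_sup => //; exists n => /=.
Qed.

Lemma limn_sup_near_lt (R : realType) (u : nat -> R) (c e : R) :
  (forall n, 0 <= u n <= c) -> 0 < e ->
  exists N, forall n, (N <= n)%N -> u n < limn_sup u + e.
Proof.
move=> uc e0; have [-> _ ubd] := limn_sup_inf uc.
have : inf (range (sups u)) < inf (range (sups u)) + e by rewrite ltrDl.
case/inf_lt; first by exists (sups u 0); exists 0%N.
move=> _ [N _ <-] lt; exists N => n Nn; apply: le_lt_trans lt.
by apply: ub_le_sup => //; exists n => /=.
Qed.

Lemma limn_sup_le (R : realType) (u : nat -> R) (c l : R) (N : nat) :
  (forall n, 0 <= u n <= c) -> (forall n, (N <= n)%N -> u n <= l) -> limn_sup u <= l.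
Proof.
move=> uc ul; have [-> lb ubd] := limn_sup_inf uc.
apply: (@le_trans _ _ (sups u N)); first by apply: ge_inf => //; exists N.
apply: ge_sup; first by exists (u N); exists N => /=.
by move=> _ [n /= Nn <-]; exact: ul.
Qed.

Lemma limn_sup_bounds (R : realType) (u : nat -> R) (c : R) :
  (forall n, 0 <= u n <= c) -> 0 <= limn_sup u <= c.
Proof.
move=> uc; apply/andP; split.
  apply/ler_addgt0Pr => e e0; have [N /(_ N (leqnn N))] := limn_sup_near_lt uc e0.
  by move=> /ltW; apply: le_trans; case/andP: (uc N).
by apply: (limn_sup_le (N := 0) uc) => n _; case/andP: (uc n).
Qed.

(** Passes an inequality between consecutive times to the limsups; the time shift disappears in the
    limit. *)
Lemma limn_sup_combination (R : realType) (u v w : nat -> R) (a b c : R) :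
  (forall n, 0 <= u n <= c) -> (forall n, 0 <= v n <= c) -> (forall n, 0 <= w n <= c) ->
  0 <= a -> 0 <= b -> (forall n, u n.+1 <= a * v n + b * w n) ->
  limn_sup u <= a * limn_sup v + b * limn_sup w.
Proof.
move=> uc vc wc a0 b0 h; apply/ler_addgt0Pr => e e0.
(* The summand [1] keeps the divisor positive when [a] and [b] both vanish. *)
have d0 : 0 < a + b + 1 by rewrite ltr_wpDl // addr_ge0.
have e1 : 0 < e / (a + b + 1) by rewrite divr_gt0.
have [N1 h1] := limn_sup_near_lt vc e1.
have [N2 h2] := limn_sup_near_lt wc e1.
apply: (limn_sup_le (N := (maxn N1 N2).+1) uc) => -[//|n]; rewrite ltnS geq_max.
move=> /andP[/h1 /ltW n1 /h2 /ltW n2]; apply: le_trans (h n) _.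
have e2 : e = (a + b + 1) * (e / (a + b + 1)) by rewrite mulrC divfK // gt_eqF.
have := ler_wpM2l a0 n1; have := ler_wpM2l b0 n2.
rewrite [X in _ -> _ -> _ <= _ + X]e2; move: (e / _) e1 => d d1; lra.
Qed.

Lemma limn_supZ_le (R : realType) (u : nat -> R) (a c : R) :
  0 < a -> (forall n, 0 <= u n <= c) ->
  limn_sup (fun n => a * u n) <= a * limn_sup u.
Proof.
move=> a0 uc; apply/ler_addgt0Pr => e e0.
have e1 : 0 < e / a by rewrite divr_gt0.
have [N h] := limn_sup_near_lt uc e1.
apply: (@limn_sup_le _ _ (a * c) _ N) => n; last first.
  by move=> /h/ltW; rewrite -(ler_pM2l a0) mulrDr [a * (e / a)]mulrC divfK // gt_eqF.
by case/andP: (uc n) => u0 u1; rewrite mulr_ge0 ?ler_wpM2l // ltW.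
Qed.

Lemma limn_supZ (R : realType) (u : nat -> R) (a c : R) :
  0 < a -> (forall n, 0 <= u n <= c) ->
  limn_sup (fun n => a * u n) = a * limn_sup u.
Proof.
move=> a0 uc; apply/eqP; rewrite eq_le (limn_supZ_le a0 uc) /=.
have auc n : 0 <= a * u n <= a * c.
  by case/andP: (uc n) => u0 u1; rewrite mulr_ge0 ?ler_wpM2l // ltW.
have ai : 0 < a^-1 by rewrite invr_gt0.
(* The reverse inequality is the same bound for the factor [a^-1] and the sequence [a * u n]. *)
have := limn_supZ_le ai auc.
under eq_fun do rewrite mulKf ?gt_eqF //.
by rewrite -(ler_pM2l a0) mulVKf // gt_eqF.
Qed.

(** * Unordered sums and geometric series *)

Lemma esumZ_le (R : realType) (T : choiceType) (I : set T) (a : T -> R) (c : R) :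
  0 <= c ->
  (\esum_(i in I) (c * a i)%:E <= c%:E * \esum_(i in I) (a i)%:E)%E.
Proof.
move=> c0; apply: ge_ereal_sup => /= _ [X [finX XI]] <-.
rewrite fsbig_finite //= sumEFin -mulr_sumr EFinM lee_wpmul2l ?lee_fin //.
by apply: ereal_sup_ubound; exists X => //; rewrite fsbig_finite //= sumEFin.
Qed.

(** The total is finite, so it can be cancelled: the nonnegative differences [b i - a i] have sum at
    most zero, and each of them vanishes. *)
Lemma eq_of_esum_le (R : realType) (T : choiceType) (I : set T) (a b : T -> R) :
  (forall i, I i -> 0 <= a i <= b i) ->
  (\esum_(i in I) (b i)%:E < +oo)%E ->
  (\esum_(i in I) (b i)%:E <= \esum_(i in I) (a i)%:E)%E ->
  forall i, I i -> a i = b i.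
Proof.
move=> ab bfin ba i Ii; apply/eqP; rewrite eq_le; case/andP: (ab i Ii) => a0 -> /=.
have a_fin : \esum_(i in I) (a i)%:E \is a fin_num.
  rewrite ge0_fin_numE; last by apply: esum_ge0 => j /ab /andP[]; rewrite lee_fin.
  by apply: le_lt_trans bfin; apply: le_esum => j /ab /andP[_]; rewrite lee_fin.
have e : (\esum_(i in I) (b i)%:E =
          \esum_(i in I) (a i)%:E + \esum_(i in I) (b i - a i)%:E)%E.
  rewrite -esumD.
  - by apply: eq_esum => j _; rewrite -EFinD addrC subrK.
  - by move=> j /ab /andP[]; rewrite lee_fin.
  - by move=> j /ab /andP[_]; rewrite lee_fin subr_ge0.
move: ba; rewrite e -{2}(adde0 (\esum_(i in I) (a i)%:E)) leeD2lE // => le0.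
have : ((b i - a i)%:E <= 0)%E.
  apply: le_trans le0; apply: esum_ge; exists [set i].
    by split => // j ->.
  by rewrite fsbig_set1.
by rewrite lee_fin subr_le0.
Qed.

Lemma esum_geometric_nat (R : realType) (r : R) : 0 <= r < 1 ->
  (\esum_(n in [set: nat]) (r ^+ n)%:E <= ((1 - r)^-1)%:E)%E.
Proof.
move=> /andP[r0 r1]; rewrite -nneseries_esumT => [|n]; last by rewrite lee_fin exprn_ge0.
apply: lime_le; first by apply: is_cvg_nneseries => n _; rewrite lee_fin exprn_ge0.
apply: nearW => n; rewrite sumEFin lee_fin big_mkord.
have d0 : 0 < 1 - r by rewrite subr_gt0.
rewrite -(ler_pM2l d0) divff ?gt_eqF // -opprB mulNr -subrX1 opprB.
by rewrite gerBl exprn_ge0.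
Qed.

Lemma esum_geometric_int (R : realType) (r : R) : 0 <= r < 1 ->
  (\esum_(v in [set: int]) (r ^+ absz v)%:E <= (2 * (1 - r)^-1)%:E)%E.
Proof.
move=> /[dup] /andP[r0 r1] rr.
rewrite (esumID [set v : int | 0 <= v]) => [|v _]; last by rewrite lee_fin exprn_ge0.
have -> : setT `&` [set v : int | 0 <= v] = Posz @` setT.
  by rewrite setTI; apply/seteqP; split => [[n|n] //= _|_ [n _ <-] //]; exists n.
have -> : setT `&` ~` [set v : int | 0 <= v] = Negz @` setT.
  by rewrite setTI; apply/seteqP; split => [[n|n] //=|_ [n _ <-] //]; exists n.
rewrite !esum_image; [|by move=> ? ? _ _ []..].
rewrite mulrDl mul1r EFinD leeD //; first exact: esum_geometric_nat.
(* [Negz n] has absolute value [n.+1]; the extra factor [r] is at most one. *)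
apply: le_trans (esum_geometric_nat rr); apply: le_esum => n _.
by rewrite lee_fin /= exprS ler_piMl ?exprn_ge0 // ltW.
Qed.

(** Induction on the length: splitting off the head turns the sum into an iterated one, which
    factors into a two-sided geometric series and the sum for shorter sequences. *)
Lemma esum_geometric_seq (R : realType) (r : R) (n : nat) : 0 <= r < 1 ->
  (\esum_(x in [set x : seq int | size x = n]) (\prod_(v <- x) r ^+ absz v)%:E < +oo)%E.
Proof.
move=> /[dup] /andP[r0 r1] rr.
have P0 (x : seq int) : 0 <= \prod_(v <- x) r ^+ absz v.
  by rewrite prodr_ge0 // => v _; rewrite exprn_ge0.
elim: n => [|n IH].
  rewrite [X in \esum_(_ in X) _](_ : _ = [set [::]]).
    by rewrite esum_set1 ?lee_fin // ltry.
  by apply/seteqP; split => x /=; [case: x|move=> ->].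
rewrite (reindex_esum ([set: int] `*`` fun=> [set x : seq int | size x = n]) _
  (fun k => k.1 :: k.2)); last first.
  split => /=.
  - by move=> [v x] /= [_ ->].
  - by move=> [v x] [w y] _ _ /= [-> ->].
  - by case=> [|v x] //= [h]; exists (v, x).
under eq_esum do rewrite big_cons.
rewrite -(@esum_esum _ _ _ _ _ (fun v x => (r ^+ absz v * \prod_(w <- x) r ^+ absz w)%:E));
  last by move=> v x _ _; rewrite lee_fin mulr_ge0 // exprn_ge0.
set S := \esum_(_ in _) _ in IH.
have S0 : (0 <= S)%E by apply: esum_ge0 => x _; rewrite lee_fin.
have Sfin : S \is a fin_num by rewrite ge0_fin_numE.
apply: (@le_lt_trans _ _ (\esum_(v in [set: int]) (fine S * r ^+ absz v)%:E)).
  apply: le_esum => v _; apply: le_trans (esumZ_le _ _ _) _; first exact: exprn_ge0.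
  by rewrite -/S -(fineK Sfin) -EFinM lee_fin mulrC.
apply: le_lt_trans (esumZ_le _ _ _) _; first exact: fine_ge0.
apply: le_lt_trans (lee_wpmul2l _ (esum_geometric_int rr)) _.
  by rewrite lee_fin fine_ge0.
by rewrite -EFinM ltry.
Qed.

(** * Moving the last entry to the front *)

(** The sequences [xseq s] of BDM states: minus the sum is $T$, so the bounds are $0\le T\le M$. *)
Definition inX (M : nat) (x : seq int) : bool :=
  (size x == M.+1) && (0 <= - \sum_(a <- x) a <= M%:Z).

(** Actions (c) and (d) read on [xseq]: at clock $M+1$ the entry [d] is last, at clock $1$ it is
    first. *)
Definition wrap (M : nat) (x : seq int) : seq int :=
  let b := take M x in let d := x`_M in
  if - \sum_(a <- x) a < M%:Z then d - 1 :: b else d :: map (fun a => a + 1) b.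

(** The inverse of [wrap]: the new value of $T$ is positive after action (c) and zero after action
    (d), which tells the two apart. *)
Definition unwrap (y : seq int) : seq int :=
  if y is h :: b then
    if 0 < - \sum_(a <- y) a then rcons b (h + 1) else rcons (map (fun a => a - 1) b) h
  else [::].

Lemma sum_shift (x : seq int) (c : int) :
  \sum_(a <- map (fun a => a + c) x) a = \sum_(a <- x) a + (size x)%:Z * c.
Proof. by rewrite big_map big_split /= sum_const_seq. Qed.

Lemma sum_rcons (b : seq int) (d : int) :
  \sum_(a <- rcons b d) a = \sum_(a <- b) a + d.
Proof. by rewrite -cats1 big_cat big_seq1. Qed.

Lemma wrap_rcons (M : nat) (b : seq int) (d : int) : size b = M ->
  wrap M (rcons b d) =
  if - (\sum_(a <- b) a + d) < M%:Z then d - 1 :: b else d :: map (fun a => a + 1) b.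
Proof.
by move=> sb; rewrite /wrap sum_rcons nth_rcons -cats1 -sb take_size_cat // ltnn eqxx.
Qed.

Lemma inX_rconsP (M : nat) (x : seq int) : inX M x ->
  exists b d, [/\ x = rcons b d, size b = M & 0 <= - (\sum_(a <- b) a + d) <= M%:Z].
Proof.
case/andP => /eqP sx; case/lastP: x sx => // b d.
by rewrite size_rcons sum_rcons => -[sb] h; exists b, d.
Qed.

Lemma inX_consP (M : nat) (x : seq int) : inX M x ->
  exists h b, [/\ x = h :: b, size b = M & 0 <= - (h + \sum_(a <- b) a) <= M%:Z].
Proof.
by case/andP => /eqP; case: x => // h b [sb]; rewrite big_cons => ?; exists h, b.
Qed.

Lemma inX_wrap (M : nat) (x : seq int) : inX M x -> inX M (wrap M x).
Proof.
move=> /inX_rconsP [b [d [-> sb]]]; rewrite wrap_rcons // /inX.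
move: (fun c => sum_shift b c); case: ifP => lt sh h.
  rewrite /= sb eqxx big_cons /=; move: (bigop _ _ _) lt h => S; lia.
rewrite /= size_map sb eqxx big_cons sh sb /=; move: (bigop _ _ _) lt h => S; lia.
Qed.

Lemma inX_unwrap (M : nat) (y : seq int) : inX M y -> inX M (unwrap y).
Proof.
case: y => [|h b] /andP[/eqP // [sb]] sumy; rewrite /inX /unwrap; move: sumy.
rewrite big_cons; case: ifP => lt; rewrite size_rcons ?size_map sb eqxx /=
  -cats1 big_cat big_seq1 /= ?sum_shift ?sb.
  by move: (bigop _ _ _) lt => S; lia.
by move: (bigop _ _ _) lt => S; lia.
Qed.

Lemma wrapK (M : nat) (x : seq int) : inX M x -> unwrap (wrap M x) = x.
Proof.
move=> /inX_rconsP [b [d [-> sb]]]; rewrite wrap_rcons // => h.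
case: ifP => lt; rewrite /unwrap big_cons ?sum_shift.
  rewrite ifT ?subrK //; move: (bigop _ _ _) lt h => S; lia.
rewrite ifF; last by rewrite sb; move: (bigop _ _ _) lt h => S; lia.
by rewrite -map_comp (eq_map (g := id)) ?map_id // => a /=; rewrite addrK.
Qed.

Lemma unwrapK (M : nat) (y : seq int) : inX M y -> wrap M (unwrap y) = y.
Proof.
move=> /inX_consP [h [b [-> sb]]] hy; rewrite /unwrap big_cons.
case: ifP => lt; rewrite wrap_rcons ?size_map // ?sum_shift.
  by rewrite ifT ?addrK //; move: (bigop _ _ _) lt hy => S; lia.
rewrite ifF; last by rewrite sb; move: (bigop _ _ _) lt hy => S; lia.
by rewrite -map_comp (eq_map (g := id)) ?map_id // => a /=; rewrite subrK.
Qed.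

(** Pairs with the moved entry are reflected as in [phi_reflect]; the remaining entries are shifted
    together or not at all. *)
Lemma energy_unwrap (y : seq int) : energy (unwrap y) = energy y.
Proof.
case: y => [|h b] //; rewrite /unwrap; case: ifP => _; rewrite -cats1 /energy
  pairsum_cat /= !big_nil !addr0 addrC; congr (_ + _).
- by apply: eq_bigr => a _; rewrite big_seq1 -[RHS]phi_reflect; congr phi; lia.
- by rewrite big_map; apply: eq_bigr => a _; rewrite big_seq1 -[RHS]phi_reflect; congr phi; lia.
elim: b => //= a s ->; rewrite big_map; congr (_ + _).
by apply: eq_bigr => c _; congr phi; lia.
Qed.

(** * Invariance under permutations and under [unwrap] *)

Lemma inX_perm (M : nat) (x y : seq int) : perm_eq x y -> inX M x = inX M y.
Proof. by move=> xy; rewrite /inX (perm_size xy) (perm_big _ xy). Qed.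

Lemma inX_adjswap (M : nat) (x : seq int) (i : nat) : inX M (adjswap x i) = inX M x.
Proof. exact/inX_perm/perm_adjswap. Qed.

Lemma noninc_perm_eq (x y : seq int) : noninc x -> noninc y -> perm_eq x y -> x = y.
Proof. by apply: sorted_eq => [a b c | a b]; lia. Qed.

Lemma swap_invariant_perm (V : Type) (M : nat) (J : seq int -> V) :
  (forall x i, inX M x -> (i < M)%N -> J (adjswap x i) = J x) ->
  forall x y, inX M x -> perm_eq x y -> J x = J y.
Proof.
move=> Jswap.
have Jfold (f : seq nat) x : inX M x -> all (fun i => (i < size x)%N) f ->
    perm_eq (foldl adjswap x f) x /\ J (foldl adjswap x f) = J x.
  elim: f x => [|i f IH] x xX //= /andP[ix fx].
  have [|//|p ->] := IH (adjswap x i); first by rewrite inX_adjswap.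
    by rewrite size_adjswap.
  split; first exact: perm_trans p (perm_adjswap x i).
  have sx : size x = M.+1 by case/andP: xX => /eqP.
  have [iM|Mi] := ltnP i M; first exact: Jswap.
  (* At the last position there is no right neighbour and [adjswap] is the identity. *)
  by rewrite /adjswap ifF // sx ltnS ltnNge Mi.
have Jsort x : inX M x -> exists z, [/\ noninc z, perm_eq z x & J z = J x].
  move=> xX; have [n hn] : exists n : nat, inversions x = n%:Z.
    by exists `|inversions x|%N; have := inversions_ge0 x; lia.
  have [f [_ fx nf]] := sort_by_swaps hn.
  by exists (foldl adjswap x f); have [] := Jfold f x xX fx.
move=> x y xX xy; have yX : inX M y by rewrite -(inX_perm _ xy).
have [zx [nx px <-]] := Jsort _ xX; have [zy [ny py <-]] := Jsort _ yX.
congr J; apply: noninc_perm_eq => //.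
by rewrite (perm_trans px) // (perm_trans xy) // perm_sym.
Qed.

(* Up to permutation, [unwrap] raises one chosen entry as long as the sum is
   negative; this allows to bring the entries to [0] one unit at a time. *)
Lemma unwrap_invariant_const (V : Type) (M : nat) (J : seq int -> V) : (1 <= M)%N ->
  (forall x i, inX M x -> (i < M)%N -> J (adjswap x i) = J x) ->
  (forall x, inX M x -> J (unwrap x) = J x) ->
  forall x, inX M x -> J x = J (nseq M.+1 0).
Proof.
move=> M1 /swap_invariant_perm Jperm Junwrap.
have Jincr (a : int) b : inX M (a :: b) -> \sum_(c <- a :: b) c < 0 ->
    inX M (a + 1 :: b) /\ J (a + 1 :: b) = J (a :: b).
  move=> X neg; have e : unwrap (a :: b) = rcons b (a + 1).
    by rewrite /unwrap ifT // oppr_gt0.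
  have p : perm_eq (rcons b (a + 1)) (a + 1 :: b) by rewrite perm_rcons.
  have X' : inX M (rcons b (a + 1)) by rewrite -e inX_unwrap.
  by rewrite -(inX_perm _ p) -(Jperm _ _ X' p) -e inX_unwrap ?Junwrap.
(* Induction on the l1-norm of [x]. *)
move=> x; have [n] := ubnP (absz (\sum_(a <- x) `|a|)).
elim: n x => // n IH x; rewrite ltnS => hn xX.
have shorter a b c : perm_eq x (a :: b) -> `|c| + 1 = `|a| ->
    (absz (\sum_(v <- c :: b) `|v|)%R < n)%N.
  move=> p h; move: hn; rewrite (perm_big _ p) !big_cons /=.
  have : 0 <= \sum_(v <- b) `|v| by apply: sumr_ge0.
  by move: (bigop _ _ _) => S; lia.
have sumx := xX; move/andP: sumx => [/eqP sx sumx].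
have [neg|sum0] := ltP (\sum_(a <- x) a) 0.
  have /hasP [a ax a0] : has (fun a => a < 0) x.
    apply: contraLR neg => /hasPn ge0; rewrite -leNgt big_seq sumr_ge0 // => a /ge0.
    by rewrite -leNgt.
  have p := perm_to_rem ax.
  have X : inX M (a :: rem a x) by rewrite -(inX_perm _ p).
  have [|X' JJ] := Jincr a (rem a x) X; first by rewrite -(perm_big _ p).
  by rewrite (Jperm _ _ xX p) -JJ IH // (shorter a) //; lia.
(* Here the sum is zero. Lowering a positive entry gives sum $-1$, admissible since $M\ge1$, and
   raising that entry again leads back to [x]. *)
have [/hasP [a ax a0]|] := boolP (has (fun a => 0 < a) x).
  have p := perm_to_rem ax.
  have e : \sum_(v <- x) v = a + \sum_(v <- rem a x) v by rewrite (perm_big _ p) big_cons.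
  have X : inX M (a - 1 :: rem a x).
    move: sumx sum0; rewrite /inX big_cons /= e.
    rewrite size_rem // sx eqxx /=; move: (bigop _ _ _) => S; lia.
  have [|X' JJ] := Jincr (a - 1) (rem a x) X.
    by move: sumx sum0; rewrite big_cons e; move: (bigop _ _ _) => S; lia.
  rewrite (Jperm _ _ xX p); move: JJ; rewrite subrK => ->.
  by rewrite IH // (shorter a) //; lia.
move/hasPn => le0; congr J; rewrite -sx; apply/all_pred1P/allP => a ax /=.
have p := perm_to_rem ax; move: sum0; rewrite (perm_big _ p) big_cons.
have : \sum_(v <- rem a x) v <= 0.
  rewrite big_seq; apply: sumr_le0 => v /mem_rem /le0; by rewrite -leNgt.
by have := le0 a ax; rewrite -leNgt /=; move: (bigop _ _ _) => S; lia.
Qed.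

(** * The stationary measure and subharmonic functions *)

Definition weight (R : realType) (q : nat) (x : seq int) : R := q%:R ^ (- energy x).

Lemma weight_gt0 (R : realType) (q : nat) (x : seq int) : (2 <= q)%N ->
  0 < weight R q x.
Proof. by move=> q2; rewrite exprz_gt0 // ltr0n; lia. Qed.

Lemma weight_adjswap (R : realType) (M q : nat) (x : seq int) (i : nat) :
  (2 <= q)%N -> size x = M.+1 -> (i < M)%N -> x`_i < x`_i.+1 ->
  weight R q (adjswap x i) = q%:R^-1 * weight R q x.
Proof.
move=> q2 sx iM lt; have q0 : q%:R != 0 :> R by rewrite pnatr_eq0; lia.
by rewrite /weight energy_adjswap ?sx // opprD expfzDr // mulrC.
Qed.

Lemma esum_weight_fin (R : realType) (M q : nat) : (1 <= M)%N -> (2 <= q)%N ->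
  (\esum_(x in [set x | inX M x]) (weight R q x)%:E < +oo)%E.
Proof.
move=> M1 q2; have q1 : 1 < q%:R :> R by rewrite ltr1n.
have q0 : 0 < q%:R :> R by apply: lt_trans q1.
have r1 : 0 <= (q%:R^-1 : R) < 1 by rewrite invr_ge0 ltW //= invf_lt1.
pose C := 2 * (M.+1 ^ 2)%N%:Z; pose g (x : seq int) : R := \prod_(v <- x) q%:R^-1 ^+ absz v.
have g0 x : 0 <= g x by apply: prodr_ge0 => v _; rewrite exprn_ge0 //; case/andP: r1.
have gE x : q%:R ^ (- \sum_(v <- x) `|v|) = g x.
  rewrite /g; elim: x => [|v x IH]; first by rewrite !big_nil oppr0 expr0z.
  rewrite !big_cons opprD expfzDr ?gt_eqF // IH; congr (_ * _).
  by rewrite -abszE -exprz_inv.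
apply: (@le_lt_trans _ _ (\esum_(x in [set x : seq int | size x = M.+1]) (q%:R ^ C * g x)%:E)).
  rewrite [leRHS]esum_mkcond esum_mkcond; apply: le_esum => x _.
  have [|_] := ifPn; last by case: ifP => // _; rewrite lee_fin mulr_ge0 // exprz_ge0 // ltW.
  rewrite inE /= => /andP[/eqP sx sumx]; rewrite ifT ?inE // lee_fin.
  rewrite -gE -expfzDr ?gt_eqF // /weight ler_weXz2l // ?(ltW q1) //.
  by have := energy_lower_bound sx sumx M1; rewrite -/C; move: (bigop _ _ _) => S; lia.
apply: le_lt_trans (esumZ_le _ _ _) _; first by rewrite exprz_ge0 // ltW.
by rewrite lte_mul_pinfty ?lee_fin ?exprz_ge0 ?ltW // (esum_geometric_seq _ r1).
Qed.

(** The reversed probability of coming from [y] itself. At an ascent, action $D$ brings mass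
    $(1-1/q)w(y)$ from [y], and the swapped sequence, of weight $w(y)/q$, sends all its mass;
    otherwise everything comes from the swap. *)
Definition stay (R : realType) (q : nat) (y : seq int) (i : nat) : R :=
  if y`_i < y`_i.+1 then 1 - q%:R^-1 else 0.

(* One step of the time-reversed chain, for the stationary measure [weight]. *)
Definition average (R : realType) (q : nat) (F : seq int -> R) (y : seq int) (i : nat) : R :=
  stay R q y i * F y + (1 - stay R q y i) * F (adjswap y i).

Lemma stay_bounds (R : realType) (q : nat) (y : seq int) (i : nat) : (2 <= q)%N ->
  0 <= stay R q y i < 1.
Proof.
move=> q2; have q1 : 1 < q%:R :> R by rewrite ltr1n.
have q0 : 0 < q%:R :> R by apply: lt_trans q1.
have i1 : (q%:R^-1 : R) < 1 by rewrite invf_lt1.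
have i0 : 0 < (q%:R^-1 : R) by rewrite invr_gt0.
by rewrite /stay; case: ifP; lra.
Qed.

(** Stationarity of [weight] for the swap steps: after reindexing the second part by the involution
    [adjswap], the two coefficients of [F y] add up to the weight of [y]. *)
Lemma esum_average (R : realType) (M q : nat) (F : seq int -> R) (i : nat) :
  (2 <= q)%N -> (i < M)%N -> (forall y, inX M y -> 0 <= F y) ->
  \esum_(y in [set y | inX M y]) (weight R q y * average q F y i)%:E =
  \esum_(y in [set y | inX M y]) (weight R q y * F y)%:E.
Proof.
move=> q2 iM F0.
have w0 y : 0 < weight R q y by exact: weight_gt0.
pose g1 y := weight R q y * (stay R q y i * F y).
pose g2 y := weight R q y * ((1 - stay R q y i) * F (adjswap y i)).
have g10 y : inX M y -> 0 <= g1 y.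
  move=> yX; case/andP: (stay_bounds R y i q2) => s0 s1.
  by rewrite !mulr_ge0 ?F0 // ltW.
have g20 y : inX M y -> 0 <= g2 y.
  move=> yX; case/andP: (stay_bounds R y i q2) => s0 s1.
  by rewrite !mulr_ge0 ?F0 ?inX_adjswap ?subr_ge0 // ltW.
transitivity (\esum_(y in [set y | inX M y]) ((g1 y)%:E + (g2 y)%:E)).
  by apply: eq_esum => y _; rewrite -EFinD /g1 /g2 /average mulrDr.
rewrite esumD; [|by move=> y /g10; rewrite lee_fin|by move=> y /g20; rewrite lee_fin].
rewrite (reindex_esum [set y | inX M y] [set y | inX M y] (fun y => adjswap y i) (fun y => (g2 y)%:E)).
  2: { split => [y|x y _ _|y] /=.
       - by rewrite inX_adjswap.
       - by move/(congr1 (fun z => adjswap z i)); rewrite !adjswapK.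
       - by move=> yX; exists (adjswap y i); rewrite /= ?inX_adjswap ?adjswapK. }
rewrite -esumD; first last.
- by move=> y yX; rewrite lee_fin g20 // inX_adjswap.
- by move=> y /g10; rewrite lee_fin.
apply: eq_esum => y yX; rewrite -EFinD /g1 /g2 adjswapK; congr EFin.
have sy : size y = M.+1 by case/andP: (yX : inX M y) => /eqP.
have [e1 e2] : (adjswap y i)`_i = y`_i.+1 /\ (adjswap y i)`_i.+1 = y`_i.
  by apply: adjswap_nth; rewrite sy.
have q0 : q%:R != 0 :> R by rewrite pnatr_eq0; lia.
rewrite /stay e1 e2; have [lt|gt|eq] := ltgtP y`_i y`_i.+1.
- by rewrite (weight_adjswap _ q2 sy iM lt); field.
- have sy' : size (adjswap y i) = M.+1 by rewrite size_adjswap.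
  have := @weight_adjswap R M q _ i q2 sy' iM; rewrite e1 e2 adjswapK => /(_ gt) ->.
  by ring.
- by rewrite adjswap_id //; ring.
Qed.

Lemma sqr_le_combination (R : realType) (s a b l : R) : 0 <= s < 1 -> 0 <= l ->
  l <= s * a + (1 - s) * b -> l ^+ 2 <= s * a ^+ 2 + (1 - s) * b ^+ 2.
Proof.
move=> /andP[s0 s1] l0 le; have t0 : 0 < 1 - s by rewrite subr_gt0.
have : l ^+ 2 <= (s * a + (1 - s) * b) ^+ 2 by rewrite ler_pXn2r ?nnegrE // (le_trans l0).
have : 0 <= s * (1 - s) * (a - b) ^+ 2 by rewrite mulr_ge0 ?sqr_ge0 // mulr_ge0 // ltW.
by lra.
Qed.

(** The convexity gap of the square is $s(1-s)(a-b)^2$. Equality forces it to vanish, and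
    $1-s>0$. *)
Lemma sqr_eq_combination (R : realType) (s a b l : R) : 0 <= s < 1 ->
  0 <= a -> 0 <= b -> 0 <= l -> l <= s * a + (1 - s) * b ->
  l ^+ 2 = s * a ^+ 2 + (1 - s) * b ^+ 2 -> l = b /\ (s = 0 \/ a = b).
Proof.
move=> /andP[s0 s1] a0 b0 l0 le eq; have t0 : 0 < 1 - s by rewrite subr_gt0.
have lq : l ^+ 2 <= (s * a + (1 - s) * b) ^+ 2 by rewrite ler_pXn2r ?nnegrE // (le_trans l0).
have eqs : s * (1 - s) * (a - b) ^+ 2 <= 0 by lra.
have {eqs} : s * (1 - s) * (a - b) ^+ 2 == 0.
  by rewrite eq_le eqs mulr_ge0 ?sqr_ge0 // mulr_ge0 // ltW.
rewrite mulf_eq0 sqrf_eq0 mulf_eq0 (gt_eqF t0) orbF subr_eq0 => /orP[/eqP e|/eqP e].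
  split; last by left.
  by apply/eqP; rewrite -(eqrXn2 (n := 2)) // eq e; apply/eqP; ring.
split; last by right.
by apply/eqP; rewrite -(eqrXn2 (n := 2)) // eq e; apply/eqP; ring.
Qed.

(* [\sum weight * L ^ 2] cannot increase along a full cycle of time steps, so it
   is constant; being finite, it forces equality in Jensen's inequality. *)
Lemma subharmonic_const (R : realType) (M q : nat) (L : seq int -> nat -> R) :
  (1 <= M)%N -> (2 <= q)%N ->
  (forall y i, inX M y -> (i <= M)%N -> 0 <= L y i <= 1) ->
  (forall y i, inX M y -> (i < M)%N -> L y i.+1 <= average q (fun z => L z i) y i) ->
  (forall y, inX M y -> L y 0%N <= L (unwrap y) M) ->
  forall y i, inX M y -> (i <= M)%N -> L y i = L (nseq M.+1 0) 0%N.
Proof.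
move=> M1 q2 L01 Lstep Lwrap.
have w0 y : 0 < weight R q y by exact: weight_gt0.
have w0' y : 0 <= weight R q y by exact: ltW.
have sqr_mono (a b : R) : 0 <= a <= b -> a ^+ 2 <= b ^+ 2.
  by case/andP => a0 ab; rewrite ler_pXn2r ?nnegrE // (le_trans a0).
pose G (F : seq int -> R) := \esum_(y in [set y | inX M y]) (weight R q y * F y)%:E.
pose E i := G (fun y => L y i ^+ 2).
pose A i := G (fun y => average q (fun z => L z i ^+ 2) y i).
have Efin i : (i <= M)%N -> (E i < +oo)%E.
  move=> iM; apply: le_lt_trans (esum_weight_fin R M1 q2); apply: le_esum => y yX.
  rewrite lee_fin ler_piMr //; case/andP: (L01 y i yX iM) => l0 l1.
  by rewrite exprn_ile1.
have avgsq y i : inX M y -> (i < M)%N ->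
    L y i.+1 ^+ 2 <= average q (fun z => L z i ^+ 2) y i.
  move=> yX iM; apply: sqr_le_combination; first exact: stay_bounds.
    by case/andP: (L01 y i.+1 yX iM).
  exact: Lstep.
have AE i : (i < M)%N -> A i = E i.
  by move=> iM; apply: esum_average => // y yX; rewrite sqr_ge0.
have EA i : (i < M)%N -> (E i.+1 <= A i)%E.
  by move=> iM; apply: le_esum => y yX; rewrite lee_fin ler_wpM2l // avgsq.
have unwrap_bij : set_bij [set y | inX M y] [set y | inX M y] unwrap.
  split => [y|x y /set_mem xX /set_mem yX|y] /=.
  - exact: inX_unwrap.
  - by move/(congr1 (wrap M)); rewrite !unwrapK.
  - by move=> yX; exists (wrap M y); rewrite /= ?inX_wrap ?wrapK.
(* [unwrap] permutes the admissible sequences and preserves their weight. *)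
have EM : E M = G (fun y => L (unwrap y) M ^+ 2).
  rewrite /E /G (reindex_esum _ _ _ _ unwrap_bij); apply: eq_esum => y _.
  by rewrite /weight energy_unwrap.
have E0 : (E 0%N <= E M)%E.
  rewrite EM; apply: le_esum => y yX; rewrite lee_fin ler_wpM2l // sqr_mono //.
  by rewrite Lwrap // andbT; case/andP: (L01 y 0%N yX (leq0n M)).
have Edec i j : (i <= j)%N -> (j <= M)%N -> (E j <= E i)%E.
  move=> /subnK <-; elim: (j - i)%N => //= k IH kM.
  by apply: le_trans (IH (ltnW kM)); rewrite addSn -(AE (k + i)%N) // EA.
(* The cycle $E_0\le E_M\le E_i\le E_0$ closes. *)
have EE i : (i <= M)%N -> E i = E 0%N.
  move=> iM; apply/eqP; rewrite eq_le (Edec 0%N i) //=.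
  by apply: le_trans E0 _; exact: Edec.
have stepE y i : inX M y -> (i < M)%N -> L y i.+1 = L (adjswap y i) i /\
    (y`_i < y`_i.+1 -> L y i = L (adjswap y i) i).
  move=> yX iM.
  have : weight R q y * L y i.+1 ^+ 2 =
         weight R q y * average q (fun z => L z i ^+ 2) y i.
    apply: (@eq_of_esum_le R _ [set y | inX M y] (fun y => weight R q y * L y i.+1 ^+ 2)
      (fun y => weight R q y * average q (fun z => L z i ^+ 2) y i)) => //=.
    - by move=> z zX; rewrite mulr_ge0 ?sqr_ge0 //= ler_wpM2l // avgsq.
    - by have := Efin i (ltnW iM); rewrite -(AE i iM).
    - by change (A i <= E i.+1)%E; rewrite (AE i iM) (EE i (ltnW iM)) (EE i.+1 iM).
  move/(mulfI (lt0r_neq0 (w0 y))) => eq.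
  have [|||-> alt] := sqr_eq_combination (stay_bounds R y i q2) _ _ _ (Lstep y i yX iM) eq.
  - by case/andP: (L01 y i yX (ltnW iM)).
  - by case/andP: (L01 (adjswap y i) i (etrans (inX_adjswap M y i) yX) (ltnW iM)).
  - by case/andP: (L01 y i.+1 yX iM).
  (* At an ascent the staying probability is $1-1/q$, nonzero because $q\ge2$; so the alternative is
     equality of the two averaged values. *)
  split => // lt; case: alt => //; rewrite /stay lt => /eqP.
  rewrite subr_eq0 eq_sym invr_eq1 -[1]/(1%:R) eqr_nat; lia.
have Lsym y i : inX M y -> (i < M)%N -> L (adjswap y i) i = L y i.
  move=> yX iM; have [lt|gt|eq] := ltgtP y`_i y`_i.+1.
  - by rewrite (proj2 (stepE y i yX iM) lt).
  - have sy : size y = M.+1 by case/andP: yX => /eqP.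
    have [e1 e2] : (adjswap y i)`_i = y`_i.+1 /\ (adjswap y i)`_i.+1 = y`_i.
      by apply: adjswap_nth; rewrite sy.
    by rewrite (proj2 (stepE (adjswap y i) i _ iM)) ?adjswapK ?inX_adjswap ?e1 ?e2.
  - by rewrite adjswap_id.
have Lconst y i : inX M y -> (i <= M)%N -> L y i = L y 0%N.
  move=> yX; elim: i => // i IH iM.
  by rewrite (proj1 (stepE y i yX iM)) Lsym // IH // ltnW.
have Lunwrap y : inX M y -> L (unwrap y) 0%N = L y 0%N.
  move=> yX; rewrite -(Lconst (unwrap y) M) ?inX_unwrap //; apply/esym/eqP.
  have : weight R q y * L y 0%N ^+ 2 = weight R q y * L (unwrap y) M ^+ 2.
    apply: (@eq_of_esum_le R _ [set y | inX M y] (fun y => weight R q y * L y 0%N ^+ 2)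
      (fun y => weight R q y * L (unwrap y) M ^+ 2)) => //=.
    - move=> z zX; rewrite mulr_ge0 ?sqr_ge0 //= ler_wpM2l // sqr_mono //.
      by rewrite Lwrap // andbT; case/andP: (L01 z 0%N zX (leq0n M)).
    - by have := Efin M (leqnn M); rewrite EM.
    - by move: (EE M (leqnn M)); rewrite EM /G => ->.
  move/(mulfI (lt0r_neq0 (w0 y)))/eqP; rewrite eqrXn2 //.
    by case/andP: (L01 y 0%N yX (leq0n M)).
  by case/andP: (L01 (unwrap y) M (inX_unwrap yX) (leqnn M)).
move=> y i yX iM; rewrite Lconst //.
apply: (unwrap_invariant_const (J := fun y => L y 0%N) M1) => // x k xX kM.
by rewrite -(Lconst (adjswap x k) k) ?inX_adjswap ?Lsym ?(ltnW kM) // Lconst // ltnW.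
Qed.

(** * The chain in terms of [xseq] and the clock *)

(* The class and the dynamics only depend on [xseq s] and the clock [st_t s];
   the variable [T] is recovered from the sum of [xseq s]. *)
Definition code (s : state) : seq int * nat := (xseq s, st_t s).

(** With [d] at index [t.-1] and $b_t$ at index [t], action $D$ keeps the sequence, while $I$, $N_<$
    and $N_=$ swap the two entries, trivially so for $N_=$. *)
Definition code_step (R : realType) (M q : nat) (z : seq int * nat) : seq (R * (seq int * nat)) :=
  let: (x, t) := z in
  if (t <= M)%N then
    if x`_t.-1 < x`_t then
      [:: ((q%:R - 1) / q%:R, (x, t.+1)); (1 / q%:R, (adjswap x t.-1, t.+1))]
    else [:: (1, (adjswap x t.-1, t.+1))]
  else [:: (1, (wrap M x, 1%N))].

Lemma in_SP (M : nat) (s : state) :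
  reflect (exists s1 s2 d T, [/\ s = ((s1 ++ s2, d), T, (size s1).+1),
     size (s1 ++ s2) = M, - T = \sum_(a <- s1 ++ d :: s2) a & 0 <= T <= M%:Z])
  (in_S M s).
Proof.
apply: (iffP idP) => [|[s1 [s2 [d [T [-> sM sumE T0]]]]]].
  case: s => [[[b d] T] t] /and3P[/and4P[/eqP /= sb /eqP /= sumE t1 tM] T0 TM].
  move: sb sumE t1 tM T0 TM; rewrite /st_b /st_d /st_T /st_t /= => sb sumE t1 tM T0 TM.
  exists (take t.-1 b), (drop t.-1 b), d, T; rewrite cat_take_drop T0 TM; split => //.
    by congr (_, _); rewrite size_takel; lia.
  have p : perm_eq (take t.-1 b ++ d :: drop t.-1 b) (d :: b).
    by rewrite perm_catC /= perm_cons perm_catC cat_take_drop.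
  by rewrite (perm_big _ p) big_cons /=; move: sumE; lra.
rewrite /in_S /in_Sbar /st_b /st_d /st_T /st_t /= sM eqxx /= T0 andbT.
rewrite -sM size_cat ltnS leq_addr andbT.
by move: sumE; rewrite !big_cat big_cons /=; lra.
Qed.

Lemma xseqE (s1 s2 : seq int) (d T : int) :
  xseq ((s1 ++ s2, d), T, (size s1).+1) = s1 ++ d :: s2.
Proof. by rewrite /xseq /st_b /st_d /st_t /= take_size_cat ?drop_size_cat. Qed.

Lemma in_S_code (M : nat) (s : state) : in_S M s ->
  inX M (xseq s) /\ (1 <= st_t s <= M.+1)%N.
Proof.
move=> /in_SP [s1 [s2 [d [T [-> sM sumE T0]]]]]; rewrite xseqE /inX -sumE opprK T0.
rewrite /st_t /= -sM !size_cat /= addnS eqxx; split => //; lia.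
Qed.

(** The clock locates [d] inside the sequence, and $T$ is minus the sum. *)
Lemma code_inj (M : nat) (s s' : state) : in_S M s -> in_S M s' -> code s = code s' -> s = s'.
Proof.
move=> /in_SP [s1 [s2 [d [T [-> sM sumE T0]]]]] /in_SP [s1' [s2' [d' [T' [-> sM' sumE' T0']]]]].
rewrite /code !xseqE /st_t /= => -[e1 e2].
have eT : T = T' by apply: oppr_inj; rewrite sumE sumE' e1.
by move/eqP: e1; rewrite eqseq_cat // eT e2 => /andP[/eqP -> /eqP [-> ->]].
Qed.

Lemma step_code (R : realType) (M q : nat) (s : state) : in_S M s ->
  [seq (y.1, code y.2) | y <- step R M q s] = code_step R M q (code s).
Proof.
move=> /in_SP [s1 [s2 [d [T [-> sM sumE T0]]]]].
rewrite /code /code_step xseqE /step /st_t /st_b /st_d /st_T /=.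
have [lt|ge] := ltnP (size s1) M.
  case: s2 sM sumE => [|b s2] sM sumE; first by rewrite cats0 in sM; lia.
  have e1 : (s1 ++ b :: s2)`_(size s1) = b by rewrite nth_cat ltnn subnn.
  have e2 : (s1 ++ d :: b :: s2)`_(size s1) = d by rewrite nth_cat ltnn subnn.
  have e3 : (s1 ++ d :: b :: s2)`_(size s1).+1 = b.
    by rewrite nth_cat ltnNge leqnSn /= subSnn.
  have e4 : set_nth 0 (s1 ++ b :: s2) (size s1) d = s1 ++ d :: s2.
    by elim: s1 {lt sM sumE e1 e2 e3} => //= c s1 ->.
  have e5 : adjswap (s1 ++ d :: b :: s2) (size s1) = s1 ++ b :: d :: s2.
    have [|s3 [s4 [ss e ->]]] := @adjswapP (s1 ++ d :: b :: s2) (size s1).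
      by rewrite size_cat /=; lia.
    move/eqP: e; rewrite e2 e3 eqseq_cat ?ss // => /andP[/eqP -> /eqP [<-]].
    by [].
  have x1 d' T' : xseq ((s1 ++ d :: s2, d'), T', (size s1).+2) = s1 ++ d :: d' :: s2.
    by have := xseqE (rcons s1 d) s2 d' T'; rewrite size_rcons !cat_rcons.
  have x2 d' T' : xseq ((s1 ++ b :: s2, d'), T', (size s1).+2) = s1 ++ b :: d' :: s2.
    by have := xseqE (rcons s1 b) s2 d' T'; rewrite size_rcons !cat_rcons.
  rewrite e1 e2 e3 e4 e5; case: ifP => _ /=; rewrite ?x1 x2 //.
have e0 : s2 = [::].
  by apply/nilP; rewrite /nilp; move: sM; rewrite size_cat; lia.
move: sM sumE; rewrite e0 cats0 => sM sumE.
rewrite cats1 wrap_rcons // -sum_rcons -cats1 -sumE opprK.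
have x1 b' d' T' : xseq ((b', d'), T', 1%N) = d' :: b' by rewrite /xseq /= take0 drop0.
by case: ifP => _ /=; rewrite x1.
Qed.

Lemma step_in_S (R : realType) (M q : nat) (s : state) : in_S M s ->
  all (fun y => in_S M y.2) (step R M q s).
Proof.
move=> /in_SP [s1 [s2 [d [T [-> sM sumE T0]]]]].
rewrite /step /st_t /st_b /st_d /st_T /=.
have [lt|ge] := ltnP (size s1) M.
  case: s2 sM sumE => [|b s2] sM sumE; first by rewrite cats0 in sM; lia.
  have e1 : (s1 ++ b :: s2)`_(size s1) = b by rewrite nth_cat ltnn subnn.
  have e4 : set_nth 0 (s1 ++ b :: s2) (size s1) d = s1 ++ d :: s2.
    by elim: s1 {lt sM sumE e1} => //= c s1 ->.
  have D : in_S M ((s1 ++ d :: s2, b), T, (size s1).+2).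
    apply/in_SP; exists (rcons s1 d), s2, b, T; rewrite size_rcons !cat_rcons; split => //.
    by move: sM; rewrite !size_cat.
  have I : in_S M ((s1 ++ b :: s2, d), T, (size s1).+2).
    apply/in_SP; exists (rcons s1 b), s2, d, T; rewrite size_rcons !cat_rcons; split => //.
    by move: sumE; rewrite !big_cat !big_cons /=; lra.
  by rewrite e1 e4; case: ifP => _ /=; rewrite I ?D.
have e0 : s2 = [::].
  by apply/nilP; rewrite /nilp; move: sM; rewrite size_cat; lia.
move: sM sumE; rewrite e0 cats0 cats1 sum_rcons => sM sumE.
case: ifP => lt /=; rewrite andbT; apply/in_SP.
  exists [::], s1, (d - 1), (T + 1); rewrite /= sM big_cons; split => //; last by lia.
  by move: sumE; lra.
exists [::], (map (fun a => a + 1) s1), d, 0.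
rewrite /= size_map sM big_cons sum_shift sM; split => //; lia.
Qed.

(** * The law of the coded chain and its density *)

Definition nu (R : realType) (M q tau : nat) (z : seq int * nat) : R :=
  \sum_(x <- dist R M q tau | code x.2 == z) x.1.

Lemma s0_in_S (M : nat) : in_S M (s0 M).
Proof.
rewrite /in_S /in_Sbar /s0 /st_b /st_d /st_T /st_t /= size_nseq eqxx leqnn.
by rewrite big1_seq ?lexx // => a; rewrite mem_nseq => /andP[_ /andP[_ /eqP ->]].
Qed.

Lemma xseq_s0 (M : nat) : xseq (s0 M) = nseq M.+1 0.
Proof.
by have := xseqE (nseq M 0) [::] 0 0; rewrite cats0 size_nseq /s0 => ->; rewrite -addn1 nseqD.
Qed.

Lemma dist_in_S (R : realType) (M q tau : nat) :
  {in dist R M q tau, forall x, in_S M x.2}.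
Proof.
elim: tau => [|n IH] x /=; first by rewrite inE => /eqP -> /=; exact: s0_in_S.
move=> /flattenP [_ /mapP [y yd ->] /mapP [z zs ->]] /=.
by have /allP := step_in_S R q (IH y yd); apply.
Qed.

Lemma mu_nu (R : realType) (M q tau : nat) (s : state) : in_S M s ->
  mu R M q tau s = nu R M q tau (code s).
Proof.
move=> sS; rewrite /mu /nu big_seq_cond [RHS]big_seq_cond; apply: eq_bigl => x.
apply: andb_id2l => /dist_in_S xS; apply/eqP/eqP => [-> //|]; exact: code_inj xS sS.
Qed.

Lemma nuS (R : realType) (M q tau : nat) (z : seq int * nat) :
  nu R M q tau.+1 z = \sum_(x <- dist R M q tau)
    x.1 * \sum_(y <- code_step R M q (code x.2) | y.2 == z) y.1.
Proof.
rewrite /nu [dist _ _ _ _]/= big_flatten big_map big_seq [RHS]big_seq; apply: eq_bigr => x xd.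
by rewrite -(step_code R q (dist_in_S xd)) !big_map mulr_sumr.
Qed.

(** Reads a forward equation off the one-step probabilities: only [w1] and [w2] can lead to [z].
    They may coincide, in which case the coefficients add. *)
Lemma nu_linear (R : realType) (M q tau : nat) (z w1 w2 : seq int * nat) (a b : R) :
  (forall x i, inX M x -> (i <= M)%N ->
     \sum_(y <- code_step R M q (x, i.+1) | y.2 == z) y.1 =
     a * ((x, i.+1) == w1)%:R + b * ((x, i.+1) == w2)%:R) ->
  nu R M q tau.+1 z = a * nu R M q tau w1 + b * nu R M q tau w2.
Proof.
move=> h; rewrite nuS /nu !mulr_sumr [in RHS]big_mkcond [X in _ = _ + X]big_mkcond -big_split /=.
rewrite big_seq [RHS]big_seq; apply: eq_bigr => x /dist_in_S xS.
have [xX /andP[t1 tM]] := in_S_code xS.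
rewrite /code -(prednK t1) h //; last by rewrite -ltnS prednK.
by do 2 case: eqP => _; rewrite ?mulr1 ?mulr0 ?addr0 ?add0r //; ring.
Qed.

Lemma nu_swap (R : realType) (M q tau : nat) (y : seq int) (i : nat) : (2 <= q)%N ->
  inX M y -> (i < M)%N ->
  nu R M q tau.+1 (y, i.+2) =
  stay R q y i * nu R M q tau (y, i.+1) +
  (* A descent in [y] comes from an ascent swapped by action $I$; in the other cases the predecessor
     swaps with probability one. *)
  (if y`_i.+1 < y`_i then q%:R^-1 else 1) * nu R M q tau (adjswap y i, i.+1).
Proof.
move=> q2 yX iM; apply: nu_linear => x k xX kM.
have q0 : q%:R != 0 :> R by rewrite pnatr_eq0; lia.
have sx : size x = M.+1 by case/andP: xX => /eqP.
have [e1 e2] : (adjswap x i)`_i = x`_i.+1 /\ (adjswap x i)`_i.+1 = x`_i.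
  by apply: adjswap_nth; rewrite sx.
have swapE z : (x == adjswap z i) = (adjswap x i == z).
  by apply/eqP/eqP => [->|<-]; rewrite adjswapK.
rewrite !xpair_eqE /code_step; have [ki|ki] := eqVneq k i; last first.
  have nk : (k.+2 == i.+2) = false by apply/eqP => -[] /eqP; exact/negP.
  have -> : (k.+1 == i.+1) = false by apply/eqP => -[] /eqP; exact/negP.
  rewrite !andbF !mulr0 addr0; case: ifP => kM'; last first.
    by rewrite big_mkcond big_seq1 /= xpair_eqE andbF.
  case: ifP => _; rewrite big_mkcond ?big_cons ?big_nil /= !xpair_eqE nk !andbF ?addr0 //.
rewrite ki eqxx !andbT /= iM swapE /stay.
have [lt|gt|eq] := ltgtP x`_i x`_i.+1.
- rewrite big_mkcond !big_cons big_nil /= !xpair_eqE eqxx !andbT.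
  have [exy|nxy] := eqVneq x y.
    have -> : (adjswap x i == y) = false.
      by apply/eqP => e; move: lt; rewrite -e1 e exy ltxx.
    by rewrite -exy lt /=; field.
  have [<-|nsy] := eqVneq (adjswap x i) y; last by rewrite /=; ring.
  by rewrite e1 e2 lt /=; field.
- rewrite big_mkcond big_seq1 /= !xpair_eqE eqxx !andbT.
  have [<-|nsy] := eqVneq (adjswap x i) y.
    have -> : (x == adjswap x i) = false.
      by apply/eqP => e; move: gt; rewrite -e1 -e ltxx.
    by rewrite e1 e2 (lt_gtF gt) /=; ring.
  have [exy|nxy] := eqVneq x y; last by rewrite /=; ring.
  by rewrite -exy (lt_gtF gt) /=; ring.
- rewrite big_mkcond big_seq1 /= !xpair_eqE eqxx !andbT (adjswap_id eq).
  by have [<-|nxy] := eqVneq x y; rewrite ?eq ?ltxx /=; ring.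
Qed.

Lemma nu_wrap (R : realType) (M q tau : nat) (y : seq int) : inX M y ->
  nu R M q tau.+1 (y, 1%N) = nu R M q tau (unwrap y, M.+1).
Proof.
move=> yX; rewrite (@nu_linear R M q tau _ (unwrap y, M.+1) (unwrap y, M.+1) 1 0).
  by rewrite mul1r mul0r addr0.
move=> x k xX kM; rewrite mul1r mul0r addr0 /code_step xpair_eqE.
have [kM'|Mk] := ltnP k M.
  have -> : (k.+1 == M.+1) = false by apply/eqP; lia.
  by rewrite andbF; case: ifP => _; rewrite big_mkcond ?big_cons ?big_nil /= !xpair_eqE !andbF ?addr0.
have -> : k = M by apply/eqP; rewrite eqn_leq kM.
rewrite eqxx andbT big_mkcond big_seq1 /= xpair_eqE eqxx andbT.
have -> : (wrap M x == y) = (x == unwrap y).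
  by apply/eqP/eqP => [<-|->]; rewrite ?wrapK ?unwrapK.
by case: eqP.
Qed.

(** The position [i] counts from zero, so it stands for clock [i.+1]. *)
Definition density (R : realType) (M q : nat) (y : seq int) (i tau : nat) : R :=
  (weight R q y)^-1 * nu R M q tau (y, i.+1).

(** Division by the stationary weight turns the forward equation into averaging for the reversed
    chain. *)
Lemma density_swap (R : realType) (M q tau : nat) (y : seq int) (i : nat) : (2 <= q)%N ->
  inX M y -> (i < M)%N ->
  density R M q y i.+1 tau.+1 = average q (fun z => density R M q z i tau) y i.
Proof.
move=> q2 yX iM; rewrite /density nu_swap // /average.
have q0 : q%:R != 0 :> R by rewrite pnatr_eq0; lia.
have w0 z : weight R q z != 0 by rewrite gt_eqF // weight_gt0.
have sy : size y = M.+1 by case/andP: yX => /eqP.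
have [e1 e2] : (adjswap y i)`_i = y`_i.+1 /\ (adjswap y i)`_i.+1 = y`_i.
  by apply: adjswap_nth; rewrite sy.
have wy := w0 y; have wsy := w0 (adjswap y i); rewrite /stay.
have [lt|gt|eq] := ltgtP y`_i y`_i.+1.
- by move: wsy; rewrite (weight_adjswap _ q2 sy iM lt) => wsy; field; rewrite wy q0.
- have sy' : size (adjswap y i) = M.+1 by rewrite size_adjswap.
  have := @weight_adjswap R M q _ i q2 sy' iM; rewrite e1 e2 adjswapK => /(_ gt) ->.
  by field; rewrite wsy q0.
- by rewrite adjswap_id //; field.
Qed.

Lemma density_wrap (R : realType) (M q tau : nat) (y : seq int) : inX M y ->
  density R M q y 0 tau.+1 = density R M q (unwrap y) M tau.
Proof. by move=> yX; rewrite /density nu_wrap // /weight energy_unwrap. Qed.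

(** The initial sequence has energy zero, hence weight one, and averaging preserves the interval
    $[0,1]$. *)
Lemma density_bounds (R : realType) (M q tau : nat) (y : seq int) (i : nat) : (2 <= q)%N ->
  inX M y -> (i <= M)%N -> 0 <= density R M q y i tau <= 1.
Proof.
move=> q2; elim: tau y i => [|n IH] y i yX iM.
  rewrite /density /nu /= big_mkcond big_seq1 /= /code xseq_s0.
  have w0 := weight_gt0 R y q2.
  case: eqP => [[ey _]|_]; last by rewrite mulr0 lexx ler01.
  by rewrite /weight -ey (energy_nseq0 M.+1) oppr0 expr0z invr1 mulr1 ler01 lexx.
case: i iM => [|i] iM; first by rewrite density_wrap // IH // inX_unwrap.
rewrite density_swap // /average.
have /andP[s0 s1] := stay_bounds R y i q2.
have /andP[a0 a1] := IH y i yX (ltnW iM).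
have /andP[b0 b1] := IH (adjswap y i) i (etrans (inX_adjswap M y i) yX) (ltnW iM).
have t0 : 0 <= 1 - stay R q y i by rewrite subr_ge0 ltW.
have := mulr_ge0 s0 a0; have := mulr_ge0 t0 b0.
have := ler_wpM2l s0 a1; have := ler_wpM2l t0 b1; lra.
Qed.

Lemma limn_sup_density_const (R : realType) (M q : nat) (y : seq int) (i : nat) :
  (1 <= M)%N -> (2 <= q)%N -> inX M y -> (i <= M)%N ->
  limn_sup (density R M q y i) = limn_sup (density R M q (nseq M.+1 0) 0).
Proof.
move=> M1 q2.
apply: (@subharmonic_const R M q (fun y i => limn_sup (density R M q y i))) => // {}y.
- by move=> {}i yX iM; apply: limn_sup_bounds => n; exact: density_bounds.
- move=> {}i yX iM; have /andP[s0 s1] := stay_bounds R y i q2.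
  apply: (@limn_sup_combination _ _ _ _ _ _ 1) => // [n|n|n||n].
  + exact: density_bounds.
  + by apply: density_bounds => //; exact: ltnW.
  + by apply: density_bounds; rewrite ?inX_adjswap // ltnW.
  + by rewrite subr_ge0 ltW.
  + by rewrite density_swap.
- move=> yX; have uX := inX_unwrap yX.
  (* The single term is padded by a zero multiple to fit the form of [limn_sup_combination]. *)
  rewrite -[leRHS]mul1r -[leRHS]addr0 -[X in _ <= _ + X](mul0r (limn_sup (density R M q (unwrap y) M))).
  apply: (@limn_sup_combination _ _ _ _ _ _ 1) => // [n|n|n|n]; try exact: density_bounds.
  by rewrite density_wrap // mul1r mul0r addr0.
Qed.

Lemma mu_infE (R : realType) (M q : nat) (s : state) : (1 <= M)%N -> (2 <= q)%N -> in_S M s ->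
  mu_inf R M q s =
  q%:R ^ (- K M s) * limn_sup (density R M q (nseq M.+1 0) 0).
Proof.
move=> M1 q2 sS; have [xX /andP[t1 tM]] := in_S_code sS.
rewrite KE; last by case/and3P: sS.
have iM : ((st_t s).-1 <= M)%N by rewrite -ltnS prednK.
rewrite -(limn_sup_density_const R M1 q2 xX iM) -/(weight R q (xseq s)).
rewrite -(limn_supZ (c := 1) (weight_gt0 R _ q2)); last by move=> n; exact: density_bounds.
rewrite /mu_inf; congr limn_sup; apply/funext => n.
by rewrite mu_nu // /code /density prednK // mulrA divff ?mul1r // gt_eqF // weight_gt0.
Qed.

Unset Implicit Arguments.

Theorem theorem11 (R : realType) (M q : nat) (hM : (1 <= M)%N) (hq : (2 <= q)%N) :
  (forall s s' : state, in_S M s -> in_S M s' ->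
     mu_inf R M q s = mu_inf R M q s' * (q%:R : R) ^ (K M s' - K M s))
  /\ (forall s : state, in_S M s ->
     mu_inf R M q s = mu_inf R M q (s0 M) * (q%:R : R) ^ (- K M s)).
Proof.
have q0 : q%:R != 0 :> R by rewrite pnatr_eq0; lia.
have ratio s s' : in_S M s -> in_S M s' ->
    mu_inf R M q s = mu_inf R M q s' * (q%:R : R) ^ (K M s' - K M s).
  move=> sS sS'; rewrite !mu_infE // mulrAC -expfzDr //; congr (_ ^ _ * _); lia.
split => // s sS; rewrite (ratio s _ sS (s0_in_S M)); congr (_ * _ ^ _).
have /and3P[s0S _ _] := s0_in_S M.
(* The initial state has class zero. *)
by rewrite (KE s0S) xseq_s0 energy_nseq0 sub0r.
Qed.
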